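(* Let $\mathcal{A}$ be a finite acyclic category, let $\mu$ be any $\mathbb{N}$-filtration of $\mathcal{A}$, and let $L$ be the length $\mathbb{N}$-filtration of the barycentric subdivision $\mathrm{Sd}(\mathcal{A})$. Then $$\chi_{\mathrm{fil}}(\mathcal{A},\mu)=\chi_{\mathrm{fil}}(\mathrm{Sd}(\mathcal{A}),L).$$
   Context: A small category is acyclic if all its endomorphisms are identities and, whenever there is a morphism $X\to Y$ with $X\neq Y$, there is no morphism $Y\to X$. The objects of an acyclic category form a poset with $x\le y$ if there is a morphism $x\to y$. A finite category has finitely many objects and morphisms. $\mathbb{N}$ is the set of non-negative integers, regarded as a poset category. For a natural number $n\ge 0$, $[n]=\{0,1,\dots,n\}$ is the poset with the usual order. For a small category $\mathcal{J}$, $\overline{N_n}(\mathcal{J})$ is the set of non-degenerate chains $x_0\xrightarrow{f_1}x_1\to\cdots\xrightarrow{f_n}x_n$ in $\mathcal{J}$, i.e. functors $[n]\to\mathcal{J}$ for which no $f_i$ is an identity, with $\overline{N_0}(\mathcal{J})=\mathrm{Ob}(\mathcal{J})$. Barycentric subdivision. $\mathrm{Sd}(\mathcal{J})$ is the small category whose set of objects is $\coprod_{n\ge0}\overline{N_n}(\mathcal{J})$. An object $X$ of length $q_X$ is regarded as a functor $X:[q_X]\to\mathcal{J}$. The set of morphisms from $X$ to $Y$ is the quotient of the set of order-preserving maps $f:[q_X]\to[q_Y]$ with $Y\circ f=X$ by the equivalence relation generated by: $f\sim g$ if for every $0\le i\le q_X$ the morphism $Y(\min\{f(i),g(i)\}\to\max\{f(i),g(i)\})$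 is an identity. Composition is induced by composition of order-preserving maps. $\mathrm{Sd}(\mathcal{J})$ is an acyclic category. An $\mathbb{N}$-filtration of an acyclic category $\mathcal{A}$ is a functor $\mu:\mathcal{A}\to\mathbb{N}$ with $\mu(x)<\mu(y)$ whenever $x<y$ in $\mathrm{Ob}(\mathcal{A})$. The length $\mathbb{N}$-filtration $L$ of $\mathrm{Sd}(\mathcal{J})$ is given by $L(\mathbf{f})=n$ for $\mathbf{f}\in\overline{N_n}(\mathcal{J})$. Euler characteristic of an $\mathbb{N}$-filtered acyclic category $(\mathcal{A},\mu)$. For natural numbers $i,n$ let $\overline{N_i}(\mathcal{A})_n$ be the set of chains $(x_0\to\cdots\to x_i)\in\overline{N_i}(\mathcal{A})$ with $\max_j\mu(x_j)=n$. Suppose each $\overline{N_i}(\mathcal{A})_n$ is finite and $\overline{N_i}(\mathcal{A})_n=\emptyset$ for $n<i$. Set $$f_\chi(\mathcal{A},\mu)(t)=\sum_{n=0}^\infty(-1)^n\Big(\sum_{i=0}^n(-1)^i\#\overline{N_i}(\mathcal{A})_n\Big)t^n\in\mathbb{Z}[[t]],$$ and $\chi_{\mathrm{fil}}(\mathcal{A},\mu)=f_\chi(\mathcal{A},\mu)(t)|_{t=-1}$ if it exists. Here, for $f(t)\in\mathbb{Z}[[t]]$, if there is a rational function $g(t)/h(t)\in\mathbb{Q}(t)$ with $f(t)=g(t)/h(t)$ in $\mathbb{Q}((t))$ and $h(-1)\ne0$, then $f|_{t=-1}=g(-1)/h(-1)$. *)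

(* Defs.v *)
From Stdlib Require Import Relation_Operators.
From mathcomp Require Import all_boot all_order all_algebra generic_quotient.
From mathcomp Require Import boolp classical_sets functions cardinality.

Set Implicit Arguments.
Unset Strict Implicit.
Unset Printing Implicit Defensive.

Import Order.TTheory GRing.Theory Num.Theory.

Local Open Scope classical_set_scope.
Local Open Scope card_scope.
Local Open Scope quotient_scope.

(* Composition is written in diagrammatic order: [comp f g] is "f, then g". *)
Record category := Category {
  ob :> Type;
  hom : ob -> ob -> Type;
  idm : forall x, hom x x;
  comp : forall x y z, hom x y -> hom y z -> hom x z;
  comp1m : forall x y (f : hom x y), comp (idm x) f = f;
  compm1 : forall x y (f : hom x y), comp f (idm y) = f;
  compA : forall x y z t (f : hom x y) (g : hom y z) (h : hom z t),
    comp f (comp g h) = comp (comp f g) h }.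

Arguments hom {c} x y.
Arguments idm {c} x.
Arguments comp {c x y z} f g.

(* An inductive family, because [f : hom x y] and [idm x : hom x x] have
   different types. *)
Inductive is_identity (C : category) : forall x y : C, hom x y -> Prop :=
  IsIdentity (x : C) : is_identity (idm x).

Record functor (C D : category) := Functor {
  fob :> C -> D;
  fmap : forall x y, hom x y -> hom (fob x) (fob y);
  fmap_id : forall x, fmap (idm x) = idm (fob x);
  fmap_comp : forall x y z (f : hom x y) (g : hom y z),
    fmap (comp f g) = comp (fmap f) (fmap g) }.

Arguments fmap {C D} f0 {x y} f.

Lemma eq_functor (C D : category) (F0 : C -> D) m1 i1 c1 m2 i2 c2 :
  (forall x y (f : hom x y), m1 x y f = m2 x y f) ->
  @Functor C D F0 m1 i1 c1 = @Functor C D F0 m2 i2 c2.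
Proof.
move=> e; have {}e : m1 = m2.
  by apply: functional_extensionality_dep => x;
     apply: functional_extensionality_dep => y; apply: funext => f.
by subst m2; rewrite (Prop_irrelevance i1 i2) (Prop_irrelevance c1 c2).
Qed.

Lemma fun_ffun (aT : finType) (rT : Type) (F : aT -> rT) :
  ([ffun x => F x] : aT -> rT) = F.
Proof. by apply: funext => x; rewrite ffunE. Qed.

Section FunctorComp.
Variables (C D E : category) (F : functor C D) (G : functor D E).

Definition functor_comp : functor C E.
Proof.
refine (@Functor C E (fun x => G (F x)) (fun x y f => fmap G (fmap F f)) _ _).
- by move=> x; rewrite !fmap_id.
- by move=> x y z f g; rewrite !fmap_comp.
Defined.

End FunctorComp.

Section PosetCat.
Variables (d : Order.disp_t) (T : porderType d).

Definition poset_cat : category.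
Proof.
refine (@Category T (fun x y => (x <= y)%O) (@lexx _ T)
  (fun x y z h k => le_trans h k) _ _ _); move=> *; exact: bool_irrelevance.
Defined.

End PosetCat.

Definition mono_functor (d d' : Order.disp_t) (T : porderType d)
    (T' : porderType d') (f : T -> T') (hf : {homo f : x y / (x <= y)%O}) :
  functor (poset_cat T) (poset_cat T').
Proof.
refine (@Functor (poset_cat T) (poset_cat T') f hf _ _);
  move=> *; exact: bool_irrelevance.
Defined.

(* The poset [n] = {0, ..., n}. *)
Notation ord_cat n := (poset_cat 'I_n.+1).

Notation nat_cat := (poset_cat nat).

Definition acyclic (C : category) : Prop :=
  (forall (x : C) (f : hom x x), f = idm x) /\
  (forall x y : C, x <> y -> hom x y -> hom y x -> False).

Record acyclic_category := AcyclicCategory {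
  acat :> category;
  acatP : acyclic acat }.

Definition finite_category (C : category) : Prop :=
  finite_set [set: C] /\ finite_set [set: {xy : C * C & hom xy.1 xy.2}].

Record nfiltration (A : acyclic_category) := NFiltration {
  nfil :> functor A nat_cat;
  nfil_lt : forall x y : A, x <> y -> hom x y -> (nfil x < nfil y)%N }.

Lemma ord_stepP n (i : 'I_n) :
  (widen_ord (leqnSn n) i <= lift ord0 i :> 'I_n.+1)%O.
Proof. by rewrite leEord /= /bump /= add1n leqnSn. Qed.

Definition ord_step n (i : 'I_n) :
    @hom (ord_cat n) (widen_ord (leqnSn n) i) (lift ord0 i) :=
  ord_stepP i.

(* Elements of \overline{N_n}(C).  For n = 0 these are the functors from the
   one-point poset, which are identified with the objects of C. *)
Record chain (C : category) (n : nat) := Chain {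
  chain_functor :> functor (ord_cat n) C;
  chain_nondeg : forall i : 'I_n, ~ is_identity (fmap chain_functor (ord_step i)) }.

Section BarycentricSubdivision.
Variable J : category.

Definition sd_ob := {n : nat & chain J n}.

Definition sd_len (X : sd_ob) : nat := tag X.

Definition sd_functor (X : sd_ob) : functor (ord_cat (sd_len X)) J :=
  chain_functor (tagged X).

Definition sd_compat (X Y : sd_ob)
    (f : {ffun 'I_(sd_len X).+1 -> 'I_(sd_len Y).+1}) : Prop :=
  exists hf : {homo f : i j / (i <= j)%O},
    functor_comp (mono_functor hf) (sd_functor Y) = sd_functor X.

Definition sd_premor (X Y : sd_ob) :=
  {f : {ffun 'I_(sd_len X).+1 -> 'I_(sd_len Y).+1} | `[< sd_compat f >]}.

Lemma min_le_max n (a b : 'I_n.+1) : (Order.min a b <= Order.max a b)%O.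
Proof. by rewrite ge_min le_max lexx. Qed.

Definition ord_min_max n (a b : 'I_n.+1) :
    @hom (ord_cat n) (Order.min a b) (Order.max a b) :=
  min_le_max a b.

Definition sd_adj (X Y : sd_ob) (f g : sd_premor X Y) : Prop :=
  forall i, is_identity (fmap (sd_functor Y) (ord_min_max (val f i) (val g i))).

Definition sd_rel (X Y : sd_ob) (f g : sd_premor X Y) : bool :=
  `[< clos_refl_sym_trans _ (@sd_adj X Y) f g >].

Lemma sd_rel_refl X Y : reflexive (@sd_rel X Y).
Proof. by move=> f; apply/asboolP; exact: rst_refl. Qed.

Lemma sd_rel_sym X Y : symmetric (@sd_rel X Y).
Proof.
by move=> f g; apply/idP/idP => /asboolP h; apply/asboolP; exact: rst_sym.
Qed.

Lemma sd_rel_trans X Y : transitive (@sd_rel X Y).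
Proof.
by move=> g f h /asboolP fg /asboolP gh; apply/asboolP; exact: rst_trans fg gh.
Qed.

Canonical sd_equiv X Y : equiv_rel (sd_premor X Y) :=
  EquivRel (@sd_rel X Y) (@sd_rel_refl X Y) (@sd_rel_sym X Y)
    (@sd_rel_trans X Y).

Definition sd_hom (X Y : sd_ob) : Type := {eq_quot (sd_equiv X Y)}.

Lemma sd_preid_subproof X :
  `[< @sd_compat X X [ffun i => i] >].
Proof.
apply/asboolP; have hf : {homo [ffun i : 'I_(sd_len X).+1 => i] : i j / (i <= j)%O}.
  by move=> i j; rewrite !ffunE.
exists hf; move: hf; rewrite /mono_functor /functor_comp /=.
rewrite fun_ffun.
move=> hf; case: (sd_functor X) => F0 m i c /=; apply: eq_functor => x y f /=.
by congr (m x y _); exact: bool_irrelevance.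
Qed.

Definition sd_preid X : sd_premor X X := 
  exist (fun f => `[< sd_compat f >]) _ (sd_preid_subproof X).

Lemma sd_precomp_subproof X Y Z (f : sd_premor X Y) (g : sd_premor Y Z) :
  `[< @sd_compat X Z [ffun i => val g (val f i)] >].
Proof.
case: f g => [f /= /asboolP [hf ef]] [g /= /asboolP [hg eg]]; apply/asboolP.
have hgf : {homo [ffun i => g (f i)] : i j / (i <= j)%O}.
  by move=> i j ij; rewrite !ffunE; exact/hg/hf.
exists hgf; rewrite -ef -eg; move: hgf; rewrite /mono_functor /functor_comp /=.
rewrite fun_ffun.
move=> hgf; apply: eq_functor => x y h /=.
by congr (fmap _ _); exact: bool_irrelevance.
Qed.

Definition sd_precomp X Y Z (f : sd_premor X Y) (g : sd_premor Y Z) :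
  sd_premor X Z :=
  exist (fun h => `[< sd_compat h >]) _ (sd_precomp_subproof f g).

Lemma is_identity_ord n (F : functor (ord_cat n) J) (a b a' b' : 'I_n.+1)
    (h : @hom (ord_cat n) a b) (h' : @hom (ord_cat n) a' b') :
  a = a' -> b = b' -> is_identity (fmap F h) -> is_identity (fmap F h').
Proof. by move=> ea eb; subst a' b'; rewrite (bool_irrelevance h h'). Qed.

Lemma sd_adj_precompr X Y Z (f f' : sd_premor X Y) (g : sd_premor Y Z) :
  sd_adj f f' -> sd_adj (sd_precomp f g) (sd_precomp f' g).
Proof.
case: g => [g hg'] adj i; rewrite /sd_precomp /=; move: (adj i).
have [hg eg] := asboolW hg'; rewrite -eg /=.
apply: is_identity_ord; rewrite !ffunE /=.
- case: (leP (val f i) (val f' i)) => [ff'|/ltW ff'].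
    by rewrite min_l // hg.
  by rewrite min_r // hg.
- case: (leP (val f i) (val f' i)) => [ff'|/ltW ff'].
    by rewrite max_r // hg.
  by rewrite max_l // hg.
Qed.

Lemma sd_adj_precompl X Y Z (f : sd_premor X Y) (g g' : sd_premor Y Z) :
  sd_adj g g' -> sd_adj (sd_precomp f g) (sd_precomp f g').
Proof.
move=> adj i; move: (adj (val f i)).
by apply: is_identity_ord; rewrite !ffunE.
Qed.

Lemma sd_rel_precomp X Y Z (f f' : sd_premor X Y) (g g' : sd_premor Y Z) :
  sd_rel f f' -> sd_rel g g' -> sd_rel (sd_precomp f g) (sd_precomp f' g').
Proof.
move=> /asboolP ff' /asboolP gg'.
apply: (@sd_rel_trans _ _ (sd_precomp f' g)); apply/asboolP.
  elim: ff' => [u v uv|u|u v _ IH|u v w _ IH1 _ IH2].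
  - by apply: rst_step; exact: sd_adj_precompr.
  - exact: rst_refl.
  - exact: rst_sym.
  - exact: rst_trans IH1 IH2.
elim: gg' => [u v uv|u|u v _ IH|u v w _ IH1 _ IH2].
- by apply: rst_step; exact: sd_adj_precompl.
- exact: rst_refl.
- exact: rst_sym.
- exact: rst_trans IH1 IH2.
Qed.

Definition sd_id X : sd_hom X X := \pi_({eq_quot (sd_equiv X X)}) (sd_preid X).

Definition sd_comp X Y Z (f : sd_hom X Y) (g : sd_hom Y Z) : sd_hom X Z :=
  \pi_({eq_quot (sd_equiv X Z)})
    (sd_precomp (repr (f : {eq_quot (sd_equiv X Y)}))
                (repr (g : {eq_quot (sd_equiv Y Z)}))).

Lemma pi_sd_comp X Y Z (f : sd_premor X Y) (g : sd_premor Y Z) :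
  sd_comp (\pi_({eq_quot (sd_equiv X Y)}) f) (\pi_({eq_quot (sd_equiv Y Z)}) g) =
  \pi_({eq_quot (sd_equiv X Z)}) (sd_precomp f g).
Proof.
apply/eqmodP; apply: sd_rel_precomp.
- by apply/eqmodP; rewrite reprK.
- by apply/eqmodP; rewrite reprK.
Qed.

Lemma sd_hom_pi X Y (f : sd_hom X Y) :
  exists p : sd_premor X Y, f = \pi_({eq_quot (sd_equiv X Y)}) p.
Proof. by exists (repr (f : {eq_quot (sd_equiv X Y)})); rewrite reprK. Qed.

Lemma sd_comp1m X Y (f : sd_hom X Y) : sd_comp (sd_id X) f = f.
Proof.
have [p ->] := sd_hom_pi f; rewrite pi_sd_comp; congr (\pi _).
by apply/val_inj/ffunP => i; rewrite /= !ffunE.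
Qed.

Lemma sd_compm1 X Y (f : sd_hom X Y) : sd_comp f (sd_id Y) = f.
Proof.
have [p ->] := sd_hom_pi f; rewrite pi_sd_comp; congr (\pi _).
by apply/val_inj/ffunP => i; rewrite /= !ffunE.
Qed.

Lemma sd_compA X Y Z T (f : sd_hom X Y) (g : sd_hom Y Z) (h : sd_hom Z T) :
  sd_comp f (sd_comp g h) = sd_comp (sd_comp f g) h.
Proof.
have [[p ->] [q ->]] := (sd_hom_pi f, sd_hom_pi g); have [r ->] := sd_hom_pi h.
rewrite !pi_sd_comp; congr (\pi _).
by apply/val_inj/ffunP => i; rewrite /= !ffunE.
Qed.

Definition Sd_cat : category :=
  @Category sd_ob sd_hom sd_id sd_comp sd_comp1m sd_compm1 sd_compA.

Lemma sd_premor_step X Y (f : sd_premor X Y) (i : 'I_(sd_len X)) :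
  (val f (widen_ord (leqnSn _) i) < val f (lift ord0 i))%N.
Proof.
case: f => [f hf'] /=; have [hf ef] := asboolW hf'.
rewrite ltn_neqAle; apply/andP; split; last exact/hf/ord_stepP.
apply/negP => /eqP/val_inj e.
apply: (chain_nondeg (c := tagged X) (i := i)).
suff : is_identity (fmap (sd_functor X) (ord_step i)) by [].
rewrite -ef /=; move: (hf _ _ _); rewrite -e => h.
rewrite (bool_irrelevance h (lexx _)).
have -> : fmap (sd_functor Y) (lexx (f (widen_ord (leqnSn (sd_len X)) i))) =
          idm _ by exact: (fmap_id (sd_functor Y)).
exact: IsIdentity.
Qed.

Lemma sd_premor_gap X Y (f : sd_premor X Y) (i j : 'I_(sd_len X).+1) :
  (i <= j)%N -> (val f i + (j - i) <= val f j)%N.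
Proof.
move=> ij; have [k ek] : exists k, (j = i + k :> nat)%N.
  by exists (j - i)%N; rewrite subnKC.
elim: k j ek {ij} => [|k IH] j ek.
  have -> : j = i by apply/val_inj; rewrite /= ek addn0.
  by rewrite subnn addn0.
have ltk : (i + k < sd_len X)%N by rewrite -ltnS (leq_trans _ (ltn_ord j)) // ek addnS.
have := IH (widen_ord (leqnSn _) (Ordinal ltk)) erefl.
have := sd_premor_step f (Ordinal ltk).
have -> : lift ord0 (Ordinal ltk) = j.
  by apply/val_inj; rewrite /= /bump /= add1n ek addnS.
rewrite ek /= !addKn addnS => h1 h2; exact: leq_ltn_trans h2 h1.
Qed.

Lemma sd_premor_len X Y : sd_premor X Y -> (sd_len X <= sd_len Y)%N.
Proof.
move=> f; have := sd_premor_gap f (leq0n (@ord_max (sd_len X)) : (ord0 <= _)%N).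
rewrite /= subn0 => h; rewrite -ltnS.
apply: leq_ltn_trans (ltn_ord (val f ord_max)); apply: leq_trans h.
exact: leq_addl.
Qed.

Lemma sd_premor_val X Y (f : sd_premor X Y) (i : 'I_(sd_len X).+1) :
  sd_len X = sd_len Y -> val f i = i :> nat.
Proof.
move=> e; apply/eqP; rewrite eqn_leq; apply/andP; split.
  have h := sd_premor_gap f (leq_ord i : (i <= @ord_max (sd_len X))%N).
  have := leq_trans h (leq_trans (leq_ord _) (eq_leq (esym e))).
  by rewrite -[X in _ -> (_ <= X)%N](subKn (leq_ord i)) leq_subRL ?leq_subr // addnC.
have := sd_premor_gap f (leq0n i : (ord0 <= _)%N).
by rewrite /= subn0; apply: leq_trans; exact: leq_addl.
Qed.

Lemma sd_premor_eq X Y : sd_premor X Y -> sd_len X = sd_len Y -> X = Y.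
Proof.
move=> f e; have := sd_premor_val f ^~ e; case: f => [f hf'] /=.
have [hf ef] := asboolW hf'; clear hf'; case: X Y e f hf ef => [n X] [m Y] /=.
move=> e; rewrite /sd_len /= in e; subst m; rewrite /sd_len /sd_functor /=.
move=> f hf ef hv; congr existT.
case: X Y ef => [X hX] [Y hY] /= ef.
suff E : X = Y by subst Y; rewrite (Prop_irrelevance hX hY).
rewrite -ef; move: hf {ef}; have -> : f = [ffun i => i].
  by apply/ffunP => i; rewrite ffunE; apply/val_inj/hv.
rewrite /mono_functor /functor_comp /=.
rewrite fun_ffun.
move=> hf; case: {hX hY} Y => F0 m i c /=; apply: eq_functor => x y h /=.
by congr (m x y _); exact: bool_irrelevance.
Qed.

Lemma Sd_acyclic : acyclic Sd_cat.
Proof.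
split=> [X f|X Y XY f g].
  have [p ->] := sd_hom_pi f; congr (\pi _).
  by apply/val_inj/ffunP => i; apply/val_inj; rewrite ffunE; exact: sd_premor_val.
apply: XY; apply: sd_premor_eq (repr (f : {eq_quot (sd_equiv X Y)})) _.
apply/eqP; rewrite eqn_leq.
rewrite (sd_premor_len (repr (f : {eq_quot (sd_equiv X Y)}))).
by rewrite (sd_premor_len (repr (g : {eq_quot (sd_equiv Y X)}))).
Qed.

Definition Sd : acyclic_category := AcyclicCategory Sd_acyclic.

Lemma sd_hom_len (X Y : sd_ob) : sd_hom X Y -> (sd_len X <= sd_len Y)%O.
Proof. by move=> f; apply: sd_premor_len (repr (f : {eq_quot _})). Qed.

Definition length_functor : functor Sd nat_cat.
Proof.
refine (@Functor Sd nat_cat sd_len sd_hom_len _ _);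
  move=> *; exact: bool_irrelevance.
Defined.

Lemma length_functor_lt (X Y : Sd) :
  X <> Y -> hom X Y -> (length_functor X < length_functor Y)%N.
Proof.
move=> XY f; rewrite ltn_neqAle; apply/andP; split; last exact: sd_hom_len f.
apply/eqP => e; apply: XY.
exact: sd_premor_eq (repr (f : {eq_quot (sd_equiv X Y)})) e.
Qed.

Definition length_filtration : nfiltration Sd := NFiltration length_functor_lt.

End BarycentricSubdivision.

Section EulerCharacteristic.
Variables (A : acyclic_category) (mu : nfiltration A).

Definition chains_at (i n : nat) : set (chain A i) :=
  [set X | (\max_(j < i.+1) mu (X j))%N = n].

Arguments chains_at : clear implicits.

(* The number of elements of S, with junk value 0 when S is infinite. *)
Definition cardinal (T : Type) (S : set T) : nat :=
  xget 0%N [set k | S #= `I_k].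

(* A power series in Z[[t]] is represented by its sequence of coefficients. *)
Definition f_chi (n : nat) : int :=
  ((-1) ^+ n * \sum_(i < n.+1) (-1) ^+ i * (cardinal (chains_at i n))%:Z)%R.

End EulerCharacteristic.

Arguments chains_at {A} mu i n.

(* f = g / h in Q((t)), for h != 0: the Cauchy product of h and f is g. *)
Definition series_eq_frac (f : nat -> int) (g h : {poly rat}) : Prop :=
  forall n, (\sum_(i < n.+1) h`_i * (f (n - i)%N)%:~R = g`_n)%R.

Definition series_value_at_m1 (f : nat -> int) (v : rat) : Prop :=
  exists g h : {poly rat},
    [/\ series_eq_frac f g h, (h.[-1] != 0)%R & v = (g.[-1] / h.[-1])%R].

Lemma series_eq_frac_cross f g h g' h' :
  series_eq_frac f g h -> series_eq_frac f g' h' -> (g * h' = g' * h)%R.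
Proof.
move=> e e'; apply/polyP => n.
pose F : {poly rat} := (\poly_(i < n.+1) (f i)%:~R)%R.
have aux (g0 h0 : {poly rat}) k : series_eq_frac f g0 h0 -> (k <= n)%N ->
    (g0`_k = (h0 * F)`_k)%R.
  move=> e0 kn; rewrite -e0 coefM; apply: eq_bigr => i _; congr (_ * _)%R.
  by rewrite coef_poly ltnS (leq_trans (leq_subr _ _) kn).
have aux2 (g0 h0 k : {poly rat}) :
    series_eq_frac f g0 h0 -> ((g0 * k)`_n = (h0 * F * k)`_n)%R.
  move=> e0; rewrite !coefM; apply: eq_bigr => i _.
  by rewrite (aux _ _ _ e0) // -ltnS.
by rewrite (aux2 _ _ _ e) (aux2 _ _ _ e') mulrAC [(h * h')%R]mulrC mulrAC.
Qed.

Lemma series_value_uniq f v w :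
  series_value_at_m1 f v -> series_value_at_m1 f w -> v = w.
Proof.
move=> [g [h [e nz ->]]] [g' [h' [e' nz' ->]]].
have /(congr1 (fun p : {poly rat} => p.[-1])%R) := series_eq_frac_cross e e'.
by rewrite !hornerM => E; apply/eqP; rewrite eqr_div // E.
Qed.

Section ChiFil.
Variables (A : acyclic_category) (mu : nfiltration A).

Definition is_chi_fil (v : rat) : Prop :=
  [/\ forall i n, finite_set (chains_at mu i n),
      forall i n, (n < i)%N -> chains_at mu i n = set0 &
      series_value_at_m1 (f_chi mu) v].

(* [None] when the Euler characteristic is not defined. *)
Definition chi_fil : option rat :=
  if pselect (exists v, is_chi_fil v) is left ex then Some (projT1 (cid ex))
  else None.

Lemma chi_filP v : chi_fil = Some v <-> is_chi_fil v.
Proof.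
rewrite /chi_fil; case: pselect => [ex|nex]; last first.
  by split=> // hv; case: nex; exists v.
case: (cid ex) => w hw /=; split=> [[<-] //|hv]; congr Some.
by case: hv hw => _ _ hv [_ _ hw]; exact: series_value_uniq hw hv.
Qed.

End ChiFil.

(* Main.v *)
From Stdlib Require Import Eqdep.
From mathcomp Require Import all_boot all_order all_algebra generic_quotient.
From mathcomp Require Import boolp classical_sets functions cardinality.
Require Import Defs.

(** Both Euler characteristics equal the alternating sum over [i] of the number
    of nondegenerate chains of length [i] in [A].

    On the side of [A]: an [N]-filtration increases strictly along the arrows
    of a nondegenerate chain.  So the largest value on a chain is taken at its
    last object and is at least its length, and since [mu] is bounded on the
    finite category [A], the series [f_chi mu] is a polynomial.  At [t = -1]
    the sign [(-1)^n] of the coefficient and that of [t^n] cancel, so the sum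
    over [n] forgets the filtration ([sum_f_chi]).

    On the side of [Sd A]: the objects of a nondegenerate chain [Y] are
    pairwise distinct, so there is at most one order-preserving [f] with
    [Y o f = X], and [Sd A] is a poset ([Sd_thin]).  The elements below a [Y]
    of length [n] are its faces, one for each strictly increasing map
    [[m] -> [n]], hence 'C(n.+1, m.+1) of length [m] ([card_faces]), and the
    alternating sum of these numbers is 1.  From this alone, induction on [Y]
    shows that the chains of [Sd A] with last object [Y], counted with sign,
    sum to [(-1)^n] ([alternating_chain_sum]): this is the usual computation of
    the Moebius function of a simplex.  The length filtration has maximum [n]
    on exactly the chains whose last object has length [n], so two signs
    cancel and the [n]-th coefficient of [f_chi] for the length filtration is
    the number of chains of length [n] in [A] ([f_chi_length]).  At [t = -1]
    this gives the alternating sum again. *)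

Set Implicit Arguments.
Unset Strict Implicit.
Unset Printing Implicit Defensive.

Import Order.TTheory GRing.Theory Num.Theory.

Local Open Scope classical_set_scope.
Local Open Scope card_scope.
Local Open Scope quotient_scope.

(** * Counting finite sets by finite types *)

Lemma card_pred_II (U : finType) (p : {pred U}) : [set` p] #= `I_#|p|.
Proof.
rewrite (card_eqr card_II).
have -> : [set` p] = enum_val @` [set: 'I_#|p|].
  apply/seteqP; split=> [u /= up|u /= [i _ <-]]; last exact: enum_valP.
  by exists (enum_rank_in up u) => //; rewrite enum_rankK_in.
by apply: inj_card_eq => i j _ _; exact: enum_val_inj.
Qed.

Lemma cardinal_eq (T : Type) (S : set T) (k : nat) :
  S #= `I_k -> cardinal S = k.
Proof.
move=> Sk; apply: xget_unique => // m Sm.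
by apply/card_eq_II; rewrite -(card_eql Sm).
Qed.

(** The way to count chains: a set in an arbitrary type is matched with a
    predicate on a finite type, where big operators are available. *)
Lemma cardinal_bij (T : Type) (U : finType) (f : T -> U) (S : set T)
    (p : {pred U}) :
  (forall x y, S x -> S y -> f x = f y -> x = y) ->
  (forall x, S x -> f x \in p) ->
  (forall u, u \in p -> exists2 x, S x & f x = u) ->
  cardinal S = #|p|.
Proof.
move=> fI fS fp; apply: cardinal_eq; rewrite -(card_eqr (card_pred_II p)).
have -> : [set` p] = f @` S.
  apply/seteqP; split=> [u /fp [x Sx <-]|u /= [x Sx <-]]; last exact: fS.
  by exists x.
rewrite card_eq_sym; apply: inj_card_eq => x y /set_mem Sx /set_mem Sy.
exact: fI.
Qed.

Lemma cardinal_set0 (T : Type) : cardinal (set0 : set T) = 0%N.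
Proof. by apply: cardinal_eq; rewrite II0. Qed.

Lemma finite_inj (T : Type) (U : finType) (f : T -> U) :
  injective f -> finite_set [set: T].
Proof.
move=> fI; have /finite_setP[k Sk] : finite_set (f @` [set: T]).
  exact: finite_finset.
apply/finite_setP; exists k; rewrite -(card_eqr Sk) card_eq_sym.
by apply: inj_card_eq => x y _ _; exact: fI.
Qed.

(** Finiteness of a plain type gives no finite type structure on it; transport
    along a bijection replaces such a structure in what follows. *)
Lemma finite_finType (T : Type) : finite_set [set: T] ->
  exists (U : finType) (f : T -> U) (g : U -> T), cancel f g /\ cancel g f.
Proof.
move=> /finite_setP[k]; rewrite (card_eqr card_II) => /card_bijP[f [g fK gK]].
exists 'I_k, (fun x => set_val (f (to_setT x))).
exists (fun i => set_val (g (to_setT i))); split=> x.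
  have -> : to_setT (set_val (f (to_setT x))) = f (to_setT x).
    by apply: val_inj.
  by rewrite fK.
have -> : to_setT (set_val (g (to_setT x))) = g (to_setT x).
  by apply: val_inj.
by rewrite gK.
Qed.

(** * Alternating sums *)

Local Open Scope ring_scope.

Definition paths_from (P : finType) (e : rel P) (k : nat) (Y : P) :
  pred (k.-tuple P) := fun t => path e Y t.

Arguments paths_from {P} e k Y t.

Lemma card_path_cons (P : finType) (e : rel P) (Y : P) (k : nat) :
  #|paths_from e k.+1 Y| =
  (\sum_(X | e Y X) #|paths_from e k X|)%N.
Proof.
under eq_bigr do rewrite -sum1_card.
rewrite pair_big_dep -sum1_card /=.
rewrite (reindex (fun p : P * k.-tuple P => cons_tuple p.1 p.2)) /=.
  by [].
exists (fun t => (thead t, behead_tuple t)) => [[X t] _|t _].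
  by congr pair; apply: val_inj.
by apply: val_inj; case/tupleP: t => x t.
Qed.

(** Removing the top element of a chain ending at [Y] leaves the empty chain or
    a chain ending at some [X] below [Y], so the signed count [w] satisfies
    [w Y = 1 - sum of w X over X < Y]; by hypothesis [(-1)^len] solves the same
    recursion.  Chains are listed from the top down, so that removing the top
    element is taking the tail of a path.  The bound [N] is kept arbitrary
    above [len Y] for the induction: the terms [X] have different lengths but
    are summed up to the same bound. *)
Lemma alternating_chain_sum (P : finType) (lt : rel P) (len : P -> nat) :
  (forall X Y, lt X Y -> (len X < len Y)%N) ->
  (forall Y, \sum_(X | lt X Y) (-1) ^+ len X = 1 - (-1) ^+ len Y :> int) ->
  forall N Y, (len Y <= N)%N ->
  \sum_(k < N.+1) (-1) ^+ k *
    #|paths_from (fun a b => lt b a) k Y|%:Z =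
  (-1) ^+ len Y.
Proof.
move=> lt_len sum_lt; set gt := fun a b => lt b a.
have c0 Y : #|paths_from gt 0 Y| = 1%N.
  rewrite (fintype.eq_card1 (x := [tuple of [::]])) // => t.
  by rewrite [t]tuple0 inE eqxx.
elim=> [|N IH] Y leN.
  rewrite big_ord_recl big_ord0 /= c0 addr0 mulr1.
  by move: leN; rewrite leqn0 => /eqP ->.
rewrite big_ord_recl /= c0 mulr1.
have -> : \sum_(i < N.+1) (-1) ^+ lift ord0 i *
       #|paths_from gt (lift ord0 i) Y|%:Z
   = - \sum_(X | lt X Y) \sum_(i < N.+1) (-1) ^+ i * #|paths_from gt i X|%:Z.
  rewrite exchange_big /= -sumrN; apply: eq_bigr => i _.
  rewrite /bump /= add1n card_path_cons exprS mulN1r mulNr.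
  by rewrite raddf_sum mulr_sumr.
rewrite (eq_bigr (fun X => (-1) ^+ len X)) => [|X ltXY].
  by rewrite sum_lt expr0 opprB addrC subrK.
by apply: IH; rewrite -ltnS (leq_trans (lt_len _ _ ltXY)).
Qed.

(** The binomial expansion of [(1 - 1)^(n + 1)] without its first term. *)
Lemma alternating_bin_sum (n : nat) :
  \sum_(m < n.+1) (-1) ^+ m * ('C(n.+1, m.+1))%:Z = 1%R :> int.
Proof.
have := exprBn (1 : int) 1 n.+1; rewrite subrr expr0n /=.
rewrite big_ord_recl /= expr0 bin0 !expr1n !mulr1 => /esym/eqP.
rewrite addr_eq0 => /eqP E; rewrite [RHS]E -sumrN.
apply: eq_bigr => i _.
rewrite /bump /= add1n exprS !expr1n !mulr1 mulN1r mulNrn opprK.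
by rewrite -mulr_natr natz.
Qed.

Lemma series_value_poly (f : nat -> int) (M : nat) :
  (forall n, (M < n)%N -> f n = 0) ->
  series_value_at_m1 f (\sum_(n < M.+1) (-1) ^+ n * f n)%:~R.
Proof.
move=> f0; exists (\poly_(i < M.+1) (f i)%:~R), 1; split.
- move=> n; rewrite big_ord_recl big1 => [|i _]; last by rewrite coef1 mul0r.
  rewrite coef1 mul1r addr0 subn0 coef_poly.
  by case: ltnP => // /f0 ->.
- by rewrite hornerC oner_eq0.
rewrite hornerC divr1 horner_poly raddf_sum; apply: eq_bigr => i _ /=.
by rewrite rmorphM rmorphXn /= mulrC.
Qed.

(** * Chains in a filtered acyclic category *)

Lemma acyclic_is_identity (A : acyclic_category) (x y : A) (f : hom x y) :
  x = y -> is_identity f.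
Proof.
by move=> e; subst y; rewrite (proj1 (acatP A) x f); exact: IsIdentity.
Qed.

(** Chains are functors on all of [[n]], while nondegeneracy and the data of a
    chain concern single steps only; this extends a transitive relation from
    steps to all pairs. *)
Lemma ord_hom_step n (P : 'I_n.+1 -> 'I_n.+1 -> Prop) :
  (forall i j k, P i j -> P j k -> P i k) ->
  (forall i : 'I_n, P (widen_ord (leqnSn n) i) (lift ord0 i)) ->
  forall i j : 'I_n.+1, (i < j)%N -> P i j.
Proof.
move=> Ptr Pstep i [j ltj]; elim: j ltj => [//|j IH] ltj /=.
have ltj' : (j < n)%N by [].
have step : P (Ordinal (ltnW ltj)) (Ordinal ltj).
  have <- : widen_ord (leqnSn n) (Ordinal ltj') = Ordinal (ltnW ltj).
    exact/val_inj.
  have <- : lift ord0 (Ordinal ltj') = Ordinal ltj.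
    by apply/val_inj; rewrite /= /bump /= add1n.
  exact: Pstep.
rewrite ltnS leq_eqVlt => /orP[/eqP ij|ij]; last exact: Ptr (IH _ ij) step.
by have -> : i = Ordinal (ltnW ltj) by exact/val_inj.
Qed.

(** A step between equal objects would be an endomorphism, hence an identity,
    contrary to nondegeneracy. *)
Lemma chain_mu_lt (A : acyclic_category) (mu : nfiltration A) n (X : chain A n)
    (i j : 'I_n.+1) : (i < j)%N -> (mu (X i) < mu (X j))%N.
Proof.
apply: (ord_hom_step (P := fun i j => (mu (X i) < mu (X j))%N)).
  by move=> a b c; exact: ltn_trans.
move=> k; apply: nfil_lt; last exact: (fmap X (ord_step k)).
move=> e; apply: (chain_nondeg (c := X) (i := k)).
exact: acyclic_is_identity.
Qed.

Lemma chain_inj (A : acyclic_category) (mu : nfiltration A) n (X : chain A n) :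
  injective X.
Proof.
move=> i j e; apply/val_inj => /=; case: (ltngtP i j) => // ij.
  by have := chain_mu_lt mu X ij; rewrite e ltnn.
by have := chain_mu_lt mu X ij; rewrite e ltnn.
Qed.

Lemma chain_mu_ge (A : acyclic_category) (mu : nfiltration A) n (X : chain A n)
  (i : 'I_n.+1) : (i <= mu (X i))%N.
Proof.
case: i; elim=> [//|i IH] lti.
exact: leq_ltn_trans (IH (ltnW lti)) (chain_mu_lt _ _ _).
Qed.

Lemma max_chain_mu (A : acyclic_category) (mu : nfiltration A) n
    (X : chain A n) : (\max_(j < n.+1) mu (X j) = mu (X ord_max))%N.
Proof.
apply/eqP; rewrite eqn_leq leq_bigmax andbT; apply/bigmax_leqP => j _.
have := leq_ord j; rewrite leq_eqVlt => /orP[/eqP jn|jn].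
  by have -> : j = ord_max by exact/val_inj.
exact/ltnW/chain_mu_lt.
Qed.

Lemma chains_at_gt (A : acyclic_category) (mu : nfiltration A) i n :
  (n < i)%N -> chains_at mu i n = set0.
Proof.
move=> ni; rewrite -subset0 => X; rewrite /chains_at /= max_chain_mu => Xn.
by have := chain_mu_ge mu X ord_max; rewrite /= Xn leqNgt ni.
Qed.

Lemma chain_functor_inj (C : category) n (X Y : chain C n) :
  chain_functor X = chain_functor Y -> X = Y.
Proof.
case: X Y => [X hX] [Y hY] /= e; subst Y.
by rewrite (Prop_irrelevance hX hY).
Qed.

(** Equality of functors without transport: two functors with different object
    maps have morphism maps in different types, so each morphism is compared
    together with its ends. *)
Lemma eq_functor_tagged (C D : category) (F G : functor C D) :
  (forall x y (f : hom x y),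
     existT (fun xy : D * D => hom xy.1 xy.2) (F x, F y) (fmap F f) =
     existT (fun xy : D * D => hom xy.1 xy.2) (G x, G y) (fmap G f)) ->
  F = G.
Proof.
case: F G => [F mF iF cF] [G mG iG cG] /= e.
have eFG : F = G by apply: funext => x; have [] := e _ _ (idm x).
subst G; apply: eq_functor => x y f; have := e x y f.
exact: inj_pair2.
Qed.
 
(** A chain is encoded by the finite table of its morphisms with their ends;
    the entries [i > j], which carry no morphism, are [None]. *)
Lemma finite_chains (C : category) n :
  finite_category C -> finite_set [set: chain C n].
Proof.
move=> [_ /finite_finType[U [u [v [uK _]]]]].
pose F (X : chain C n) : {ffun 'I_n.+1 * 'I_n.+1 -> option U} :=
  [ffun ij => if boolP (ij.1 <= ij.2)%O is AltTrue h
    then Some (u (existT (fun xy : C * C => hom xy.1 xy.2)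
                    (X ij.1, X ij.2) (fmap X (h : @hom (ord_cat n) ij.1 ij.2))))
    else None].
apply: (@finite_inj _ _ F) => X Y /ffunP e.
apply: chain_functor_inj; apply: eq_functor_tagged => i j h.
have := e (i, j); rewrite !ffunE /=.
case: {-}_ / boolP => [h'|/negP //].
by rewrite (bool_irrelevance h h') => -[] /(can_inj uK).
Qed.

(** * Chains in a thin category *)

Definition thin (C : category) := forall (x y : C) (f g : hom x y), f = g.

Lemma thin_chain_inj (C : category) n (X Y : chain C n) :
  thin C -> (forall i, X i = Y i) -> X = Y.
Proof.
move=> thC e; apply: chain_functor_inj; apply: eq_functor_tagged => i j h.
by move: (fmap X h) (fmap Y h); rewrite !e => f g; rewrite (thC _ _ f g).
Qed.

(** In a thin category the functor laws hold for free, so the morphisms from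
    [x i] to [x j] can be chosen arbitrarily. *)
Lemma chain_of_steps (C : category) n (x : 'I_n.+1 -> C) :
  thin C ->
  (forall i : 'I_n, x (widen_ord (leqnSn n) i) <> x (lift ord0 i) /\
     inhabited (hom (x (widen_ord (leqnSn n) i)) (x (lift ord0 i)))) ->
  exists X : chain C n, forall i, X i = x i.
Proof.
move=> thC x_step.
have hx (i j : ord_cat n) : hom i j -> inhabited (hom (x i) (x j)).
  rewrite /hom /= leEord leq_eqVlt => /orP[/eqP/val_inj ->|].
    exact: inhabits (idm _).
  apply: (ord_hom_step (P := fun i j => inhabited (hom (x i) (x j)))).
    by move=> a b c [f] [g]; exact: inhabits (comp f g).
  by move=> k; case: (x_step k).
have hx' (i j : ord_cat n) (h : hom i j) : hom (x i) (x j).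
  exact: inhabited_witness (hx i j h).
pose F : functor (ord_cat n) C := @Functor (ord_cat n) C x hx'
  (fun i => thC _ _ _ _) (fun i j k f g => thC _ _ _ _).
have nd (i : 'I_n) : ~ is_identity (fmap F (ord_step i)).
  move=> h; have [/= ne _] := x_step i; apply: ne.
  change (F (widen_ord (leqnSn n) i) = F (lift ord0 i)).
  by case: h.
by exists (Chain nd).
Qed.

(** * The barycentric subdivision as a poset of faces *)

Lemma sd_premor_ob (J : category) (X Y : sd_ob J) (f : sd_premor X Y) i :
  sd_functor Y (val f i) = sd_functor X i.
Proof. by case: f => f hf /=; have [hf' <-] := asboolW hf. Qed.

(** A chain is injective on objects, so the equation [Y o f = X] determines
    [f]. *)
Lemma Sd_thin (A : acyclic_category) (mu : nfiltration A) : thin (Sd A).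
Proof.
move=> X Y f g; have [[p ->] [q ->]] := (sd_hom_pi f, sd_hom_pi g).
congr (\pi _); apply/val_inj/ffunP => i.
apply: (chain_inj mu (X := tagged Y)).
by rewrite [LHS]sd_premor_ob [RHS]sd_premor_ob.
Qed.

Lemma strict_homo m n (s : 'I_m.+1 -> 'I_n.+1) :
  {homo s : i j / (i < j)%N} -> {homo s : i j / (i <= j)%O}.
Proof.
move=> hs i j; rewrite !leEord leq_eqVlt => /orP[/eqP/val_inj ->//|/hs].
exact: ltnW.
Qed.

Section Faces.
Variables (A : acyclic_category) (mu : nfiltration A).
Variables (n : nat) (Y : chain A n) (m : nat).

Lemma face_nondeg (s : 'I_m.+1 -> 'I_n.+1) (hs : {homo s : i j / (i < j)%N})
    (i : 'I_m) :
  ~ is_identity (fmap (functor_comp (mono_functor (strict_homo hs)) Y)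
                   (ord_step i)).
Proof.
move=> h.
have /= e : functor_comp (mono_functor (strict_homo hs)) Y
    (widen_ord (leqnSn m) i) =
    functor_comp (mono_functor (strict_homo hs)) Y (lift ord0 i).
  by case: h.
have := hs (widen_ord (leqnSn m) i) (lift ord0 i).
by rewrite (chain_inj mu e) ltnn /= /bump /= add1n ltnSn => /(_ isT).
Qed.

Definition face (s : 'I_m.+1 -> 'I_n.+1) (hs : {homo s : i j / (i < j)%N}) :
  sd_ob A := existT _ m (Chain (@face_nondeg s hs)).

Lemma face_premor (s : 'I_m.+1 -> 'I_n.+1) (hs : {homo s : i j / (i < j)%N}) :
  inhabited (sd_premor (face hs) (existT _ n Y)).
Proof.
have hf : `[< @sd_compat A (face hs) (existT _ n Y) [ffun i => s i] >].
  apply/asboolP.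
  have hs' : {homo [ffun i => s i] : i j / (i <= j)%O}.
    by move=> i j /(strict_homo hs); rewrite !ffunE.
  exists hs'; rewrite /face /sd_functor /=; move: hs' (strict_homo hs).
  rewrite fun_ffun => h h'.
  by rewrite (Prop_irrelevance h h').
exact: inhabits (exist (fun f => `[< sd_compat f >]) _ hf).
Qed.

Lemma eq_face (s s' : 'I_m.+1 -> 'I_n.+1) (hs : {homo s : i j / (i < j)%N})
    (hs' : {homo s' : i j / (i < j)%N}) : s =1 s' -> face hs = face hs'.
Proof. by move=> /funext e; subst s'; rewrite (Prop_irrelevance hs hs'). Qed.

Lemma face_inj (s s' : 'I_m.+1 -> 'I_n.+1) (hs : {homo s : i j / (i < j)%N})
    (hs' : {homo s' : i j / (i < j)%N}) : face hs = face hs' -> s =1 s'.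
Proof.
move=> e i; apply: (chain_inj mu (X := Y)).
exact: (congr1 (fun X : chain A m => X i) (inj_pair2 _ _ _ _ _ e)).
Qed.

(** The map underlying a morphism of the subdivision is strictly increasing
    because the source is nondegenerate. *)
Lemma faceP (X : chain A m) :
  sd_premor (existT _ m X) (existT _ n Y) ->
  exists (s : 'I_m.+1 -> 'I_n.+1) (hs : {homo s : i j / (i < j)%N}),
    existT _ m X = face hs.
Proof.
move=> f; have hs : {homo val f : i j / (i < j)%N}.
  move=> i j ij; apply: leq_trans (sd_premor_gap f (ltnW ij)).
  by rewrite -addn1 leq_add2l subn_gt0.
exists (val f), hs; congr existT; apply: chain_functor_inj => /=.
case: f hs => f hf /= hs; have [hf' ef] := asboolW hf.
rewrite -[LHS]ef; move: (strict_homo hs) => h.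
by rewrite (Prop_irrelevance h hf').
Qed.

End Faces.

Lemma nfiltration_bounded (A : acyclic_category) (mu : nfiltration A) :
  finite_set [set: A] -> exists M, forall x, (mu x <= M)%N.
Proof.
move=> /finite_finType[U [u [v [uK _]]]].
by exists (\max_(a : U) mu (v a))%N => x; rewrite -(uK x); exact: leq_bigmax.
Qed.

Lemma finite_sd_ob (A : acyclic_category) (mu : nfiltration A) :
  finite_category A -> finite_set [set: sd_ob A].
Proof.
move=> finA; have [M muM] := nfiltration_bounded mu (proj1 finA).
have -> : [set: sd_ob A] =
    \bigcup_(n in `I_M.+1) (existT (chain A) n @` [set: chain A n]).
  apply/seteqP; split=> // -[n X] _; exists n; last by exists X.
  exact: leq_trans (chain_mu_ge mu X ord_max) (muM _).
by apply: bigcup_finite => // n _; apply/finite_image/finite_chains.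
Qed.

(** Strictly increasing maps [[m] -> [n]] are the increasing lists of [m + 1]
    elements of [[n]], that is, the subsets with [m + 1] elements. *)
Lemma card_faces (A : acyclic_category) (mu : nfiltration A) (P : finType)
    (u : sd_ob A -> P) (v : P -> sd_ob A) (uK : cancel u v) (vK : cancel v u)
    (Y : sd_ob A) (m : nat) :
  #|[pred p : P | `[< inhabited (sd_hom (v p) Y) >] & sd_len (v p) == m]| =
  'C((sd_len Y).+1, m.+1).
Proof.
case: Y => n Y; rewrite /sd_len /= -card_ltn_sorted_tuples.
set D := finset _.
pose T := {t : m.+1.-tuple 'I_n.+1 | t \in D}.
have tH (t : T) : {homo tnth (val t) : i j / (i < j)%N}.
  case: t => t /=; rewrite inE => st i j ij; rewrite !(tnth_nth ord0).
  have := sorted_ltn_nth ltn_trans 0%N st.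
  move=> /(_ i j); rewrite !inE size_map size_tuple !ltn_ord => /(_ isT isT ij).
  by rewrite !(nth_map ord0) ?size_tuple.
pose F (t : T) := u (face mu Y (tH t)).
have FI : injective F.
  move=> t t' /(can_inj uK)/face_inj e; apply/val_inj/eq_from_tnth; exact: e.
have -> : #|D| = #|{: T}|.
  by rewrite card_sig; apply: eq_card => t; rewrite !inE.
rewrite -(card_codom FI); apply: eq_card => p; rewrite !inE.
apply/andP/codomP => [[/asboolP [f] /eqP pm]|[t ->]].
  have f' := repr (f : {eq_quot (sd_equiv (v p) (existT _ n Y))}).
  move: f' pm (vK p) => {f}; case: (v p) => k X f /= km; subst k.
  have [s [hs es]] := faceP mu f => <-.
  have st : [tuple s i | i < m.+1] \in D.
    rewrite inE -map_comp sorted_map.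
    have : sorted ltn (map val (enum 'I_m.+1)).
      by rewrite val_enum_ord iota_ltn_sorted.
    by rewrite sorted_map; apply: sub_sorted => i j /= /hs.
  exists (exist _ [tuple s i | i < m.+1] st : T); rewrite /F es; congr u.
  by apply: eq_face => i; rewrite /= tnth_mktuple.
rewrite /F uK; split=> //; apply/asboolP.
have [f] := face_premor mu Y (tH t).
exact: inhabits (\pi_({eq_quot (sd_equiv _ _)}) f).
Qed.

(** The nonempty faces of a simplex have Euler characteristic 1. *)
Lemma alternating_face_sum (A : acyclic_category) (mu : nfiltration A)
    (P : finType) (u : sd_ob A -> P) (v : P -> sd_ob A)
    (uK : cancel u v) (vK : cancel v u) (Y : sd_ob A) :
  \sum_(p | `[< inhabited (sd_hom (v p) Y) >]) (-1) ^+ sd_len (v p) =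
  1%R :> int.
Proof.
(* A face of [Y] is at most as long as [Y], so [inord] keeps its length. *)
rewrite (partition_big
  (fun p => inord (sd_len (v p)) : 'I_(sd_len Y).+1) xpredT) //.
rewrite -[RHS](alternating_bin_sum (sd_len Y)); apply: eq_bigr => m _.
rewrite -(card_faces mu uK vK Y m) -sum1_card raddf_sum mulr_sumr /=.
apply: eq_big => [p|p /andP[/asboolP[f] /eqP <-]].
  rewrite inE; case: asboolP => [[f]|//] /=; rewrite -val_eqE /= inordK //.
  by rewrite ltnS; exact: sd_hom_len f.
by rewrite inordK ?mulr1 // ltnS; exact: sd_hom_len f.
Qed.

Lemma proper_face_sum (A : acyclic_category) (mu : nfiltration A)
    (P : finType) (u : sd_ob A -> P) (v : P -> sd_ob A)
    (uK : cancel u v) (vK : cancel v u) (q : P) :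
  \sum_(p | `[< v p <> v q /\ inhabited (sd_hom (v p) (v q)) >])
    (-1) ^+ sd_len (v p) = 1 - (-1) ^+ sd_len (v q) :> int.
Proof.
have := alternating_face_sum mu uK vK (v q); rewrite (bigD1 q) /=; last first.
  by apply/asboolP/inhabits; exact: sd_id.
rewrite addrC => /(canRL (addrK _)) <-; apply: eq_bigl => p.
apply/asboolP/andP.
  by move=> [ne h]; split; [exact/asboolP|apply/eqP => e; apply: ne; rewrite e].
by move=> [/asboolP h /eqP ne]; split=> // /(can_inj vK).
Qed.

(** In a thin acyclic category a chain is a strictly increasing sequence of
    objects; read backwards it is a path that descends from its last object,
    and the filtration takes its maximum at that object. *)
Lemma cardinal_thin_chains (C : acyclic_category) (P : finType)
    (u : C -> P) (v : P -> C) (uK : cancel u v) (vK : cancel v u)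
    (mu : nfiltration C) (k n : nat) :
  thin C ->
  cardinal (chains_at mu k n) =
  (\sum_(q | mu (v q) == n)
    #|paths_from (fun a b =>
        `[< v b <> v a /\ inhabited (hom (v b) (v a)) >]) k q|)%N.
Proof.
move=> thC.
set gt : rel P :=
  fun a b => `[< v b <> v a /\ inhabited (hom (v b) (v a)) >].
rewrite (eq_bigr (fun q => \sum_(t | paths_from gt k q t) 1)%N) => [|q _];
  last by rewrite -sum1_card.
rewrite pair_big_dep sum1dep_card /=.
(* The object of index [k] is the first component of [f Z]; entry [i] of the
   path is the object of index [k - i.+1]. *)
pose d (i : 'I_k) : 'I_k.+1 := widen_ord (leqnSn k) (rev_ord i).
pose f (Z : chain C k) := (u (Z ord_max), [tuple u (Z (d i)) | i < k]).
have f_nth (Z : chain C k) x0 i (ik : (i <= k)%N) :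
    nth x0 ((f Z).1 :: (f Z).2) i = u (Z (rev_ord (Ordinal (ik : i < k.+1)%N))).
  case: i ik => [|i] ik.
    by congr (u (Z _)); apply/val_inj; rewrite /= subn1.
  rewrite -[LHS]/(nth x0 (f Z).2 (Ordinal ik)) -tnth_nth tnth_mktuple.
  by congr (u (Z _)); apply/val_inj; rewrite /= subSS.
apply: (cardinal_bij (f := f)) => [X Y _ _ e|X XS|].
- apply: thin_chain_inj => // i; apply: (can_inj uK).
  suff fi (Z : chain C k) : u (Z i) = nth (f X).1 ((f Z).1 :: (f Z).2) (k - i).
    by rewrite !fi e.
  rewrite (f_nth Z _ _ (leq_subr _ _)); congr (u (Z _)); apply/val_inj.
  by rewrite /= subSS subKn // leq_ord.
- rewrite inE; apply/andP; split.
    by rewrite /= uK -(max_chain_mu mu X); exact/eqP.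
  apply/(pathP (f X).1) => i; rewrite size_tuple => ik.
  rewrite (f_nth X _ i (ltnW ik)).
  rewrite -[nth _ _ i]/(nth (f X).1 ((f X).1 :: (f X).2) i.+1).
  rewrite (f_nth X _ i.+1 ik) /gt !uK; apply/asboolP.
  set a := rev_ord _; set b := rev_ord _.
  have ab : (a < b)%N by rewrite /= !subSS; exact: ltn_sub2l.
  split; first by move/(chain_inj mu) => e; rewrite e ltnn in ab.
  by apply: inhabits; apply: (fmap X); exact: ltnW.
move=> [q t]; rewrite inE /= => /andP[/eqP qn /pathP qt].
pose x (i : 'I_k.+1) := v (nth q (q :: t) (k - i)).
have [i|Z Zx] := chain_of_steps (x := x) thC.
  have k_gt0 : (0 < k)%N by exact: leq_ltn_trans (ltn_ord i).
  have := qt q (k - i.+1)%N; rewrite size_tuple ltn_subrL k_gt0 => /(_ isT).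
  move=> /asboolP.
  have -> : x (widen_ord (leqnSn k) i) = v (nth q t (k - i.+1)).
    by rewrite /x /= -(subnSK (ltn_ord i)).
  by rewrite /x /= /bump /= add1n.
exists Z.
  by rewrite /chains_at /= max_chain_mu Zx /x /= subnn.
congr pair; first by rewrite Zx /x /= subnn vK.
apply: eq_from_tnth => i; rewrite tnth_mktuple Zx /x vK /=.
by rewrite subKn ?ltn_ord //= -tnth_nth.
Qed.

(** * The two power series *)

Lemma f_chi_length (A : acyclic_category) (finA : finite_category A)
    (mu : nfiltration A) n :
  f_chi (length_filtration A) n = (cardinal [set: chain A n])%:Z.
Proof.
have [P [u [v [uK vK]]]] := finite_finType (finite_sd_ob mu finA).
rewrite /f_chi.
under eq_bigr do rewrite
  (cardinal_thin_chains (C := Sd A) uK vK _ _ _ (Sd_thin mu))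
  raddf_sum mulr_sumr.
rewrite exchange_big /=.
rewrite (eq_bigr (fun=> (-1) ^+ n)) => [|q /eqP <-]; last first.
  apply: (alternating_chain_sum (lt := fun a b : P =>
      `[< v a <> v b /\ inhabited (sd_hom (v a) (v b)) >])
      (len := fun p => sd_len (v p))) => //.
    by move=> a b /asboolP[ne [h]]; exact: (@length_functor_lt A).
  exact: (proper_face_sum mu uK vK).
have -> : cardinal [set: chain A n] = #|[pred q : P | sd_len (v q) == n]|.
  apply: (cardinal_bij (f := fun X : chain A n => u (existT _ n X))).
  - by move=> X Y _ _ e; exact: inj_pair2 (can_inj uK e).
  - by move=> X _; rewrite inE uK.
  move=> q; rewrite inE => /eqP; case: (v q) (vK q) => m X /= <- e.
  by subst m; exists X.
rewrite -sum1_card raddf_sum mulr_sumr /=; apply: eq_bigr => q _.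
by rewrite -exprD addnn -signr_odd odd_double.
Qed.

Lemma sum_cardinal_chains_at (A : acyclic_category) (mu : nfiltration A)
    (M i : nat) :
  (forall x, (mu x <= M)%N) -> finite_set [set: chain A i] ->
  (\sum_(n < M.+1) cardinal (chains_at mu i n) = cardinal [set: chain A i])%N.
Proof.
move=> muM /finite_finType[U [u [v [uK vK]]]].
have -> : cardinal [set: chain A i] = #|U|.
  apply: (cardinal_bij (f := u)) => // [X Y _ _ /(can_inj uK)//|a _].
  by exists (v a).
rewrite -sum1_card.
rewrite (partition_big (fun a => inord (mu (v a ord_max)) : 'I_M.+1) xpredT) //.
apply: eq_bigr => n _; rewrite sum1_card; apply: (cardinal_bij (f := u)).
- by move=> X Y _ _ /(can_inj uK).
- move=> X; rewrite /chains_at /= max_chain_mu => Xn.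
  by rewrite -topredE /= uK Xn inord_val; exact: eqxx.
move=> a /eqP an; exists (v a); last exact: vK.
by rewrite /chains_at /= max_chain_mu -[RHS]an /= inordK // ltnS.
Qed.

Lemma f_chi_gt (A : acyclic_category) (mu : nfiltration A) (M : nat) :
  (forall x, (mu x <= M)%N) -> forall n, (M < n)%N -> f_chi mu n = 0.
Proof.
move=> muM n Mn; rewrite /f_chi big1 ?mulr0 // => i _.
have -> : chains_at mu i n = set0.
  rewrite -subset0 => X; rewrite /chains_at /= max_chain_mu => Xn.
  by have := muM (X ord_max); rewrite Xn leqNgt Mn.
by rewrite cardinal_set0 mulr0.
Qed.

(** The sum over [n] of the chains of length [i] with maximal value [n] counts
    all chains of length [i], so no trace of [mu] remains. *)
Lemma sum_f_chi (A : acyclic_category) (mu : nfiltration A) (M : nat) :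
  (forall x, (mu x <= M)%N) -> (forall i, finite_set [set: chain A i]) ->
  \sum_(n < M.+1) (-1) ^+ n * f_chi mu n =
  \sum_(i < M.+1) (-1) ^+ i * (cardinal [set: chain A i])%:Z.
Proof.
move=> muM finch.
under [RHS]eq_bigr do
  rewrite -(sum_cardinal_chains_at muM (finch _)) raddf_sum mulr_sumr.
rewrite exchange_big /=; apply: eq_bigr => n _.
rewrite /f_chi mulrA -exprD addnn -signr_odd odd_double mul1r.
rewrite (big_ord_widen M.+1
  (fun i => (-1) ^+ i * (cardinal (chains_at mu i n))%:Z)) ?ltn_ord //.
rewrite big_mkcond; apply: eq_bigr => i _; case: ifP => // /negbT.
by rewrite -leqNgt => ni; rewrite chains_at_gt // cardinal_set0 mulr0.
Qed.

Lemma chains_gt_eq0 (A : acyclic_category) (mu : nfiltration A) (M n : nat) :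
  (forall x, (mu x <= M)%N) -> (M < n)%N -> [set: chain A n] = set0.
Proof.
move=> muM Mn; rewrite -subset0 => X _.
by have := leq_trans (chain_mu_ge mu X ord_max) (muM _); rewrite leqNgt Mn.
Qed.

Lemma finite_Sd_chains (A : acyclic_category) (mu : nfiltration A) k :
  finite_category A -> finite_set [set: chain (Sd A) k].
Proof.
move=> finA; have [P [u [v [uK vK]]]] := finite_finType (finite_sd_ob mu finA).
apply: (@finite_inj _ _ (fun Z : chain (Sd A) k => [ffun i => u (Z i)])).
move=> X Y /ffunP e; apply: thin_chain_inj (Sd_thin mu) _ => i.
by have := e i; rewrite !ffunE => /(can_inj uK).
Qed.

Theorem proposition3p13 (A : acyclic_category) (finA : finite_category A)
    (mu : nfiltration A) :
  exists v : rat, chi_fil mu = Some v /\ chi_fil (length_filtration A) = Some v.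
Proof.
have [M muM] := nfiltration_bounded mu (proj1 finA).
have finch i : finite_set [set: chain A i] by exact: finite_chains.
exists (\sum_(i < M.+1) (-1) ^+ i * (cardinal [set: chain A i])%:Z)%:~R.
split; apply/chi_filP; split.
- by move=> i n; apply: sub_finite_set (finch i).
- exact: chains_at_gt.
- by rewrite -(sum_f_chi muM finch); apply/series_value_poly/f_chi_gt.
- by move=> i n; apply: sub_finite_set (finite_Sd_chains mu i finA).
- exact: chains_at_gt.
under eq_bigr do rewrite -(f_chi_length finA mu).
apply: series_value_poly => n Mn.
by rewrite (f_chi_length finA mu) (chains_gt_eq0 muM Mn) cardinal_set0.
Qed.
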